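(* Let $F(A,b,\ell,u,c)$ be a linear program with $A\in\mathbb{R}^{V\times W}$ and let $W_I\subseteq W$ be the set of integer variables. Let $(\mathcal P,\mathcal Q,\gamma,\lambda,\delta,V_U,W_U)$ be a reflection reduction of $F(A,b,\ell,u,c)$ such that $\delta_w\in\mathbb{Z}$ for all $w\in W_I\cap W_U$ and $W_I\cap W_U$ is compatible with $\mathcal Q$. Let $\mathcal Q_I=\{Q\in\mathcal Q: Q\subseteq W_I\}$, $\Gamma=\mathrm{diag}(\gamma)$, $\Lambda=\mathrm{diag}(\lambda)$, and let $A'=\Pi_{\mathcal P}^{\top}\Gamma A_{V_U,W_U}\Lambda\widetilde{\Pi_{\mathcal Q}}$, $b'=\Pi_{\mathcal P}^{\top}\Gamma(b-A\delta)_{V_U}$, $\ell'=\Pi_{\mathcal Q}^{\top}\ell^{\lambda,\delta}_{W_U}$, $u'=\Pi_{\mathcal Q}^{\top}u^{\lambda,\delta}_{W_U}$, $c'=\widetilde{\Pi_{\mathcal Q}}^{\top}\Lambda c_{W_U}$. If $$\mathrm{conv}(\{x\in P(A,b,\ell,u) : (\Pi_{\mathcal Q}^{\top}\Lambda x_{W_U})_{\mathcal Q_I}\in\mathbb{Z}^{\mathcal Q_I}\})=\mathrm{conv}(P(A,b,\ell,u)\cap\mathbb{M}^{W_I}),$$ then the following hold: (i) For any $x\in P(A,b,\ell,u)\cap\mathbb{M}^{W_I}$, the point $y:=\Pi_{\mathcal Q}^{\top}\Lambda(x_{W_U}-\delta_{W_U})$ satisfies $y\in P(A',b',\ell',u')\cap\mathbb{M}^{\mathcal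 Q_I}$ and $c^{\top}x=c'^{\top}y+c^{\top}\delta$. (ii) For any $y\in P(A',b',\ell',u')\cap\mathbb{M}^{\mathcal Q_I}$ there exists $x\in P(A,b,\ell,u)\cap\mathbb{M}^{W_I}$ such that $c^{\top}x\le c'^{\top}y+c^{\top}\delta$.
   Context: $V$ and $W$ are disjoint finite sets; $b\in\mathbb{R}^V$, $c\in\mathbb{R}^W$, $\ell_w\in\mathbb{R}\cup\{-\infty\}$, $u_w\in\mathbb{R}\cup\{\infty\}$, $\ell\le u$. $F(A,b,\ell,u,c)$ denotes the linear program $\min\{c^{\top}x : Ax=b,\ \ell\le x\le u\}$ with feasible region $P(A,b,\ell,u)$. For an index set $S$ of some of the variables, $\mathbb{M}^{S}$ denotes the set of real vectors (on the full variable index set) whose coordinates indexed by $S$ are integers. A partition $\mathcal Q$ is compatible with a set $S$ if every part $Q\in\mathcal Q$ satisfies $Q\subseteq S$ or $Q\cap S=\emptyset$. A subscript set on a vector denotes the restriction to those coordinates. Partition matrices: for a partition $\mathcal P$ of a set $S$, $\Pi_{\mathcal P}\in\{0,1\}^{S\times\mathcal P}$ has $(\Pi_{\mathcal P})_{s,P}=1$ iff $s\in P$; $\widetilde{\Pi_{\mathcal P}}$ has entries $1/|P|$ if $s\in P$ and $0$ otherwise. Reflection reduction. Let $V_U\subseteq V$, $W_U\subseteq W$, $W_B=W\setminus W_U$, $\mathcal P$ a partition of $V_U$, $\mathcal Q$ a partition of $W_U$, $\gamma\in\{-1,1\}^{V_U}$, $\lambda\in\{-1,1\}^{W_U}$,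 $\delta\in\mathbb{R}^W$ with $\ell\le\delta\le u$. For $w\in W_U$ let $\ell^{\lambda,\delta}_w=\ell_w-\delta_w$ and $u^{\lambda,\delta}_w=u_w-\delta_w$ if $\lambda_w=1$, and $\ell^{\lambda,\delta}_w=\delta_w-u_w$ and $u^{\lambda,\delta}_w=\delta_w-\ell_w$ if $\lambda_w=-1$. With $A',b',\ell',u',c'$ as defined in the claim, $(\mathcal P,\mathcal Q,\gamma,\lambda,\delta,V_U,W_U)$ is a reflection reduction of $F(A,b,\ell,u,c)$ if: (1) for every $x\in P(A,b,\ell,u)$, $y:=\Pi_{\mathcal Q}^{\top}\Lambda(x_{W_U}-\delta_{W_U})$ lies in $P(A',b',\ell',u')$ and $c^{\top}x=c'^{\top}y+c^{\top}\delta$; (2) for every $y\in P(A',b',\ell',u')$, $x:=(\Lambda\widetilde{\Pi_{\mathcal Q}}y+\delta_{W_U},\ \delta_{W_B})$ lies in $P(A,b,\ell,u)$ and $c'^{\top}y+c^{\top}\delta=c^{\top}x$. *)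

(* Defs.v *)
From mathcomp Require Import all_boot all_order all_algebra.
From mathcomp Require Import boolp classical_sets reals constructive_ereal convex.

Set Implicit Arguments.
Unset Strict Implicit.
Unset Printing Implicit Defensive.

Import Order.TTheory GRing.Theory Num.Theory.
Local Open Scope classical_set_scope.
Local Open Scope ring_scope.

(* Throughout, a coordinate vector indexed by a set S of elements of a finType
   T is a 'cV_#|S| whose i-th entry is the coordinate at enum_val i; the
   coordinate at t : T of a vector x : 'cV_#|T| is x (enum_rank t) 0.  A family
   indexed by the parts of a partition P : {set {set T}} is a 'cV_#|P|. *)

Definition sub_idx (T : finType) (S : {set T}) (i : 'I_#|S|) : 'I_#|T| :=
  enum_rank (enum_val i).

Definition restrict (K : Type) (T : finType) (S : {set T}) (x : 'cV[K]_#|T|) :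
    'cV[K]_#|S| :=
  rowsub (@sub_idx T S) x.

(* The vector (xS, d restricted to the complement of S). *)
Definition glue (K : Type) (T : finType) (S : {set T}) (xS : 'cV[K]_#|S|)
    (d : 'cV[K]_#|T|) : 'cV[K]_#|T| :=
  \col_j (if [pick i | sub_idx i == j :> 'I_#|T|] is Some i then xS i 0
          else d j 0).

Lemma restrict_glue (K : Type) (T : finType) (S : {set T}) (xS : 'cV[K]_#|S|)
    (d : 'cV[K]_#|T|) :
  restrict S (glue xS d) = xS.
Proof.
apply/matrixP => i k; rewrite ord1 !mxE; case: pickP => [j /eqP|/(_ i)].
  by move=> /enum_rank_inj /enum_val_inj ->.
by rewrite eqxx.
Qed.

Lemma glueC (K : Type) (T : finType) (S : {set T}) (xS : 'cV[K]_#|S|)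
    (d : 'cV[K]_#|T|) (t : T) :
  t \notin S -> glue xS d (enum_rank t) 0 = d (enum_rank t) 0.
Proof.
move=> tS; rewrite !mxE; case: pickP => // i /eqP /enum_rank_inj it.
by move: tS; rewrite -it enum_valP.
Qed.

Section LP.
Context {R : realType}.

Definition le_lower n (l : 'cV[\bar R]_n) (x : 'cV[R]_n) : Prop :=
  forall i, (l i ord0 <= (x i ord0)%:E)%E.

Definition le_upper n (x : 'cV[R]_n) (u : 'cV[\bar R]_n) : Prop :=
  forall i, ((x i ord0)%:E <= u i ord0)%E.

(* l takes values in R \cup {-oo}, u in R \cup {+oo}, and l <= u. *)
Definition lp_bounds n (l u : 'cV[\bar R]_n) : Prop :=
  forall i, [/\ l i 0 != +oo%E, u i 0 != -oo%E & (l i ord0 <= u i ord0)%E].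

Definition feasible m n (A : 'M[R]_(m, n)) (b : 'cV[R]_m)
    (l u : 'cV[\bar R]_n) : set 'cV[R]_n :=
  [set x | [/\ A *m x = b, le_lower l x & le_upper x u]].

Definition objective n (c x : 'cV[R]_n) : R := (c^T *m x) 0 0.

(* D is the family of variables (a finType or a set of its elements), S the
   subfamily required to be integral. *)
Definition mixed_int (T : finType) (D : {pred T}) (S : {set T}) :
    set 'cV[R]_#|D| :=
  [set x | forall i : 'I_#|D|, enum_val i \in S -> x i 0 \is a Num.int].

Definition convex_hull n (X : set 'cV[R]_n) : set 'cV[R]_n :=
  smallest (@convex_set R 'cV[R]_n) X.

Definition compatible (T : finType) (Q : {set {set T}}) (S : {set T}) : Prop :=
  forall q, q \in Q -> q \subset S \/ q :&: S = finset.set0.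

Definition part_mx (T : finType) (S : {set T}) (P : {set {set T}}) :
    'M[R]_(#|S|, #|P|) :=
  \matrix_(s < #|S|, p < #|P|)
    if enum_val s \in (enum_val p : {set T}) then 1 else 0.

Definition avg_part_mx (T : finType) (S : {set T}) (P : {set {set T}}) :
    'M[R]_(#|S|, #|P|) :=
  \matrix_(s < #|S|, p < #|P|)
    let part : {set T} := enum_val p in
    if enum_val s \in part then #|part|%:R^-1 else 0.

Definition is_sign n (g : 'rV[R]_n) : Prop := forall i, g 0 i = 1 \/ g 0 i = -1.

(* The library convention 0 * +-oo = 0 is the intended one here. *)
Definition mul_tr_ereal m n (M : 'M[R]_(m, n)) (x : 'cV[\bar R]_m) :
    'cV[\bar R]_n :=
  \col_j (\sum_i (M i j)%:E * x i ord0)%E.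

Section Reflection.
Context {V W : finType}.
Variables (A : 'M[R]_(#|V|, #|W|)) (b : 'cV[R]_#|V|).
Variables (l u : 'cV[\bar R]_#|W|) (c : 'cV[R]_#|W|).
Variables (VU : {set V}) (WU : {set W}).
Variables (P : {set {set V}}) (Q : {set {set W}}).
Variables (gamma : 'rV[R]_#|VU|) (lambda : 'rV[R]_#|WU|) (delta : 'cV[R]_#|W|).

Definition refl_lower : 'cV[\bar R]_#|WU| :=
  \col_i (let w := sub_idx i in
          if lambda ord0 i == 1%R then l w ord0 - (delta w ord0)%:E
          else (delta w ord0)%:E - u w ord0)%E.

Definition refl_upper : 'cV[\bar R]_#|WU| :=
  \col_i (let w := sub_idx i in
          if lambda ord0 i == 1%R then u w ord0 - (delta w ord0)%:E
          else (delta w ord0)%:E - l w ord0)%E.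

Definition red_A : 'M[R]_(#|P|, #|Q|) :=
  (part_mx VU P)^T *m diag_mx gamma *m mxsub (@sub_idx V VU) (@sub_idx W WU) A
    *m diag_mx lambda *m avg_part_mx WU Q.

Definition red_b : 'cV[R]_#|P| :=
  (part_mx VU P)^T *m diag_mx gamma *m restrict VU (b - A *m delta).

Definition red_l : 'cV[\bar R]_#|Q| := mul_tr_ereal (part_mx WU Q) refl_lower.

Definition red_u : 'cV[\bar R]_#|Q| := mul_tr_ereal (part_mx WU Q) refl_upper.

Definition red_c : 'cV[R]_#|Q| :=
  (avg_part_mx WU Q)^T *m diag_mx lambda *m restrict WU c.

Definition red_feasible : set 'cV[R]_#|Q| := feasible red_A red_b red_l red_u.

Definition fold_sol (x : 'cV[R]_#|W|) : 'cV[R]_#|Q| :=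
  (part_mx WU Q)^T *m diag_mx lambda *m restrict WU (x - delta).

Definition unfold_sol (y : 'cV[R]_#|Q|) : 'cV[R]_#|W| :=
  glue (diag_mx lambda *m avg_part_mx WU Q *m y + restrict WU delta) delta.

Record reflection_reduction : Prop := ReflectionReduction {
  refl_partP : finset.partition P VU;
  refl_partQ : finset.partition Q WU;
  refl_gamma : is_sign gamma;
  refl_lambda : is_sign lambda;
  refl_lower_delta : le_lower l delta;
  refl_delta_upper : le_upper delta u;
  refl_fold : forall x, feasible A b l u x ->
    red_feasible (fold_sol x) /\
    objective c x = objective red_c (fold_sol x) + objective c delta;
  refl_unfold : forall y, red_feasible y ->
    feasible A b l u (unfold_sol y) /\
    objective red_c y + objective c delta = objective c (unfold_sol y)
}.

End Reflection.
End LP.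

Arguments mixed_int {R T} D S _.

(* Main.v *)
(* Part (ii): the unfolding of an integral [y] satisfies the relaxed integrality
   condition, so it lies in the convex hull of the mixed-integer points of the
   original program; if all of these had objective value greater than that of
   [y], so would every point of their hull. *)

Require Import Defs.
From mathcomp Require Import all_boot all_order all_algebra.
From mathcomp Require Import boolp classical_sets reals constructive_ereal convex.
From mathcomp Require Import interval_inference.

Set Implicit Arguments.
Unset Strict Implicit.
Unset Printing Implicit Defensive.

Import Order.TTheory GRing.Theory Num.Theory.
Local Open Scope classical_set_scope.
Local Open Scope ring_scope.

Lemma restrictD (K : nmodType) (T : finType) (S : {set T}) (x y : 'cV[K]_#|T|) :
  restrict S (x + y) = restrict S x + restrict S y.
Proof. by apply/matrixP => i j; rewrite !mxE. Qed.

(** An open half-space is needed so that points strictly worse than [v] cannot combine to a point of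
    value [v]. By [convex_setW] only weights strictly between 0 and 1 matter, so both scaled
    inequalities stay strict. *)
Lemma convex_objective_gt (R : realType) n (c : 'cV[R]_n) (v : R) :
  convex_set ([set x | v < objective c x] : set (convex_lmodType 'cV[R]_n)).
Proof.
apply/convex_setW => x y /set_mem /= vx /set_mem /= vy k k0 k1.
apply/mem_set; rewrite /= /objective.
have -> : conv k x y =
    k%:num *: (x : 'cV[R]_n) + (1 - k%:num) *: (y : 'cV[R]_n).
  by [].
rewrite mulmxDr -!scalemxAr mxE (mxE _ _ 0) [X in _ + X]mxE.
rewrite -[v]mul1r -{1}(subrK k%:num 1) addrC mulrDl.
by rewrite ltrD // ltr_pM2l // subr_gt0.
Qed.

Lemma diag_sign_mxK (R : realType) n (g : 'rV[R]_n) :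
  is_sign g -> diag_mx g *m diag_mx g = 1%:M.
Proof.
move=> sg; rewrite mulmx_diag; apply/matrixP => i j; rewrite !mxE.
by case: (sg i) => ->; rewrite ?mulrNN mulr1.
Qed.

(** Off the diagonal every term vanishes because distinct parts are disjoint; on it, a nonempty part
    [p] contributes [#|p|] copies of [#|p|%:R^-1]. *)
Lemma part_mxK (R : realType) (T : finType) (S : {set T}) (P : {set {set T}}) :
  finset.partition P S ->
  (part_mx S P)^T *m avg_part_mx S P = 1%:M :> 'M[R]_#|P|.
Proof.
move=> /and3P[/eqP covP trivP set0P]; apply/matrixP => p q; rewrite !mxE.
have [<-|pq] := eqVneq p q; last first.
  rewrite big1 // => s _; rewrite !mxE /=.
  case: ifP => sp; last by rewrite mul0r.
  case: ifP => sq; last by rewrite mulr0.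
  case/eqP: pq; apply: enum_val_inj.
  by rewrite -(def_pblock trivP (enum_valP p) sp)
     -(def_pblock trivP (enum_valP q) sq).
pose B : {set T} := enum_val p.
have BS : B \subset S by rewrite -covP; exact: finset.bigcup_sup (enum_valP p).
have B0 : #|B| != 0%N.
  by rewrite cards_eq0; apply: contraNneq set0P => <-; apply: enum_valP.
(* The sum over row indices becomes a sum over elements of [S], and then over [B] because
   [B \subset S]. *)
transitivity (\sum_(s in S) (if s \in B then #|B|%:R^-1 else 0 : R)).
  rewrite [RHS]big_enum_val; apply: eq_bigr => s _; rewrite !mxE /=.
  by rewrite -/B; case: ifP; rewrite ?mul1r ?mul0r.
rewrite -big_mkcondr /= (eq_bigl (mem B)); last first.
  by move=> s /=; rewrite andb_idl // => /(fintype.subsetP BS).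
by rewrite sumr_const -[LHS]mulr_natl mulfV // pnatr_eq0.
Qed.

(** The entry at a part [p] is a signed sum of the coordinates of [z] in [p]; when [p \subset I],
    all of them are integers. This serves both for [delta] and for mixed-integer points. *)
Lemma mixed_int_fold (R : realType) (T : finType) (S I : {set T})
    (P : {set {set T}}) (g : 'rV[R]_#|S|) (z : 'cV[R]_#|T|) :
  is_sign g ->
  (forall t, t \in (I :&: S)%SET -> z (enum_rank t) 0 \is a Num.int) ->
  mixed_int P [set p in P | p \subset I]%SET
    ((part_mx S P)^T *m diag_mx g *m restrict S z).
Proof.
move=> sg zI p; rewrite inE => /andP[_ pI]; rewrite -mulmxA mul_diag_mx mxE.
apply: rpred_sum => s _; rewrite !mxE.
case: ifP => sp; last by rewrite mul0r rpred0.
rewrite mul1r rpredM //; last first.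
  by apply: zI; rewrite inE (fintype.subsetP pI) //= enum_valP.
by case: (sg s) => ->; rewrite ?rpredN rpred1.
Qed.

Theorem theorem26 (R : realType) (V W : finType)
    (A : 'M[R]_(#|V|, #|W|)) (b : 'cV[R]_#|V|)
    (l u : 'cV[\bar R]_#|W|) (c : 'cV[R]_#|W|) (WI : {set W})
    (VU : {set V}) (WU : {set W}) (P : {set {set V}}) (Q : {set {set W}})
    (gamma : 'rV[R]_#|VU|) (lambda : 'rV[R]_#|WU|) (delta : 'cV[R]_#|W|)
    (QI := [set q in Q | q \subset WI]%SET)
    (A' := red_A A P Q gamma lambda) (b' := red_b A b P gamma delta)
    (l' := red_l l u Q lambda delta) (u' := red_u l u Q lambda delta)
    (c' := red_c c Q lambda) :
  lp_bounds l u ->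
  reflection_reduction A b l u c P Q gamma lambda delta ->
  (forall w, w \in (WI :&: WU)%SET -> delta (enum_rank w) 0 \is a Num.int) ->
  compatible Q (WI :&: WU)%SET ->
  convex_hull [set x | feasible A b l u x /\
                mixed_int Q QI
                  ((part_mx WU Q)^T *m diag_mx lambda *m restrict WU x)]
    = convex_hull (feasible A b l u `&` mixed_int W WI) ->
  (forall x, (feasible A b l u `&` mixed_int W WI) x ->
     let y := (part_mx WU Q)^T *m diag_mx lambda *m restrict WU (x - delta) in
     (feasible A' b' l' u' `&` mixed_int Q QI) y /\
     objective c x = objective c' y + objective c delta) /\
  (forall y, (feasible A' b' l' u' `&` mixed_int Q QI) y ->
     exists2 x, (feasible A b l u `&` mixed_int W WI) x &
       objective c x <= objective c' y + objective c delta).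
Proof.
move=> _ [partP partQ _ sgl _ _ fold unfold] deltaI _ hullE.
(* The hull hypothesis folds [x], the reduction folds [x - delta]. The two differ by the folded
   [delta], which is integral on [QI]. *)
have foldE (x : 'cV[R]_#|W|) :
    mixed_int Q QI ((part_mx WU Q)^T *m diag_mx lambda *m restrict WU x) <->
    mixed_int Q QI (fold_sol Q lambda delta x).
  have dI := mixed_int_fold (P := Q) sgl deltaI.
  rewrite /fold_sol -{1}(subrK delta x) (restrictD WU (x - delta)) mulmxDr.
  set f := _ *m restrict WU (x - delta); set d := _ *m restrict WU delta in dI *.
  by split=> xI q qQI; have := xI q qQI;
     rewrite [(f + d) q 0]mxE (rpredDr _ (dI q qQI)).
split=> [x [xf xI] y|y [yf yI]].
  have [yf yE] := fold x xf; split=> //; split=> //.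
  apply/(foldE x)/mixed_int_fold => // w /setIP[wI _].
  by apply: xI; rewrite enum_rankK.
have [xf xE] := unfold y yf.
apply: contrapT => nox.
have : convex_hull (feasible A b l u `&` mixed_int W WI)
    (unfold_sol lambda delta y).
  rewrite -hullE; apply: sub_gen_smallest; split=> //; apply/foldE.
  (* Folding is a left inverse of unfolding: the shift by [delta] cancels on [WU], the signs square
     to 1, and [part_mxK] removes the averaging. *)
  suff -> : fold_sol Q lambda delta (unfold_sol lambda delta y) = y by [].
  have := restrict_glue (diag_mx lambda *m avg_part_mx WU Q *m y + restrict WU delta)
    delta.
  rewrite -/(unfold_sol lambda delta y) /fold_sol.
  rewrite -{1}(subrK delta (unfold_sol _ _ _)).
  rewrite (restrictD WU (_ - _)) => /addIr ->.
  by rewrite !mulmxA -(mulmxA _ (diag_mx _) (diag_mx _)) diag_sign_mxK //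
     mulmx1 part_mxK // mul1mx.
set v := objective c' y + objective c delta.
(* The unfolding of [y] has objective value exactly [v], so its membership in this half-space would
   give [v < v]. *)
suff hull_gt : convex_hull (feasible A b l u `&` mixed_int W WI) `<=`
    [set x | v < objective c x] by move=> /hull_gt /=; rewrite -xE ltxx.
apply: smallest_sub => [|x xM /=]; first exact: convex_objective_gt.
by rewrite ltNge; apply/negP => xle; apply: nox; exists x.
Qed.
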